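(* Let $F_{3,3}$ be the $3$-graph on vertex set $\{1,\dots,6\}$ with $3$-edges $123, 145, 146, 156, 245, 246, 256, 345, 346, 356$. For every positive integer $n$, $$3\left\lfloor\frac n5\right\rfloor\le \mathrm{co^+ex}(n,F_{3,3})\le \frac34 n .$$
   Context: A $3$-graph is a finite $3$-uniform hypergraph; an edge is written as the concatenation of its vertices. The minimum positive co-degree $\delta_2^+(H)$ of a non-empty $3$-graph $H$ is the maximum $k$ such that every pair of vertices contained in some edge of $H$ is contained in at least $k$ distinct edges of $H$; by convention it is $0$ if $H$ has no edges. A hypergraph is $F$-free if it has no (not necessarily induced) subhypergraph isomorphic to $F$. $\mathrm{co^+ex}(n,F)$ is the maximum of $\delta_2^+(H)$ over all $n$-vertex $F$-free $3$-graphs $H$. *)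

(* Defs.v *)
From HB Require Import structures.
From mathcomp Require Import all_boot.

Set Implicit Arguments.
Unset Strict Implicit.
Unset Printing Implicit Defensive.

(* A 3-graph whose vertex set is the whole finite type T. *)
Record three_graph (T : finType) := ThreeGraph {
  edges : {set {set T}};
  edges_card3 : [forall e in edges, #|e| == 3] }.

HB.instance Definition _ (T : finType) := [isSub for @edges T].
HB.instance Definition _ (T : finType) := [Finite of three_graph T by <:].

Definition codegree (T : finType) (H : three_graph T) (P : {set T}) : nat :=
  #|[set e in edges H | P \subset e]|.

Definition positive_codegree_geq (T : finType) (H : three_graph T) (k : nat)
    : bool :=
  [forall P : {set T},
     (#|P| == 2) && [exists e in edges H, P \subset e] ==>
     (k <= codegree H P)].

(* When H has an edge, some pair lies in an edge and has codegree at most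
   #|edges H|, so bounding k by #|edges H| excludes no admissible value. *)
Definition min_positive_codegree (T : finType) (H : three_graph T) : nat :=
  if edges H == set0 then 0
  else \max_(k < #|edges H|.+1 | positive_codegree_geq H k) k.

(* A copy of F in H is the image of F under an injection of the vertex sets;
   copies are not required to be induced. *)
Definition contains (S T : finType) (F : three_graph S) (H : three_graph T)
    : bool :=
  [exists f : {ffun S -> T},
     injectiveb f && ([set f @: e | e : {set S} in edges F] \subset edges H)].

Definition is_free (S T : finType) (F : three_graph S) (H : three_graph T)
    : bool :=
  ~~ contains F H.

(* The maximum is over a nonempty family as soon as F has an edge. *)
Definition coex_pos (S : finType) (n : nat) (F : three_graph S) : nat :=
  \max_(H : three_graph 'I_n | is_free F H) min_positive_codegree H.

(* The vertices 1, ..., 6 are represented by 0, ..., 5 in 'I_6. *)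
Definition triple6 (i j k : nat) : {set 'I_6} :=
  [set inord i.-1; inord j.-1; inord k.-1].

Definition F33_edges : {set {set 'I_6}} :=
  [set:: [:: triple6 1 2 3;
             triple6 1 4 5; triple6 1 4 6; triple6 1 5 6;
             triple6 2 4 5; triple6 2 4 6; triple6 2 5 6;
             triple6 3 4 5; triple6 3 4 6; triple6 3 5 6]].

Lemma card_triple6 (i j k : nat) :
  0 < i -> i < j -> j < k -> k <= 6 -> #|triple6 i j k| = 3.
Proof.
case: i j k => [//|i] [//|j] [//|k] _; rewrite !ltnS /= => ij jk k5.
have k6 : k < 6 by [].
have j6 := ltn_trans jk k6; have i6 := ltn_trans ij j6.
have neq a b : a < 6 -> b < 6 -> a < b -> (inord a == inord b :> 'I_6) = false.
  by move=> a6 b6 ab; rewrite -val_eqE /= !inordK // ltn_eqF.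
rewrite /triple6 /= setUC cardsU1 cards2 !inE !(eq_sym (inord k)).
by rewrite !neq // (ltn_trans ij jk).
Qed.

Lemma F33_edges_card3 : [forall e in F33_edges, #|e| == 3].
Proof.
apply/forall_inP => e; rewrite !inE.
by do ![case/orP] => /eqP ->; rewrite card_triple6.
Qed.

Definition F33 : three_graph 'I_6 := ThreeGraph F33_edges_card3.

(* Main.v *)
(* Upper bound: if the minimum positive codegree k satisfies 4k > 3n and abc is
   an edge, then the set D of common neighbours of the pairs ab, ac, bc has
   more than n - k elements, so every pair contained in an edge has a neighbour
   in D.  Applied to the pair xa with x in D, this gives y in D; applied to xy,
   it gives z in D with xyz an edge, so xyz and abc span a copy of F33.

   Lower bound: colour the vertices with their residues mod 5 and take as edges
   all triples with three different colours.  Any two vertices of F33 lie in a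
   common edge, so a copy of F33 would use six different colours. *)
Require Import Defs.
From mathcomp Require Import all_boot all_order all_algebra.
From mathcomp Require Import zify lra.

Set Implicit Arguments.
Unset Strict Implicit.
Unset Printing Implicit Defensive.

Import Order.TTheory GRing.Theory Num.Theory.
Local Open Scope ring_scope.

(** * Neighbourhoods of pairs, and the upper bound *)

Section PositiveCodegree.
Local Open Scope nat_scope.
Context {T : finType} (H : three_graph T).
Implicit Types (x y z : T) (e P : {set T}) (k : nat).

Lemma edge_card3 e : e \in edges H -> #|e| = 3.
Proof. by move=> eH; apply/eqP; apply: (forall_inP (edges_card3 H)). Qed.

Lemma leq_min_positive_codegree k :
  edges H != set0 -> positive_codegree_geq H k -> k <= min_positive_codegree H.
Proof.
move=> H0 Hk; rewrite /min_positive_codegree (negbTE H0).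
have [e eH] := set0Pn _ H0.
have /card_geqP[s [us ss se]] : 2 <= #|e| by rewrite edge_card3.
have Pe : [set z in s] \subset e by apply/subsetP => z; rewrite inE => /se.
(* To be a legal index of the maximum, [k] must not exceed the number of edges; a pair inside the
   edge [e] has codegree between the two. *)
have leE : k < #|edges H|.+1.
  have /forallP/(_ [set z in s])/implyP := Hk.
  rewrite cardsE (card_uniqP us) ss eqxx /= => kP.
  rewrite ltnS; apply: leq_trans (kP _) (subset_leq_card _).
    by apply/existsP; exists e; rewrite eH.
  by apply/subsetP => e'; rewrite inE => /andP[].
exact: (@leq_bigmax_cond _ _ (fun i : 'I__ => i : nat) (Ordinal leE)).
Qed.

Lemma min_positive_codegreeP :
  0 < min_positive_codegree H ->
  edges H != set0 /\ positive_codegree_geq H (min_positive_codegree H).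
Proof.
rewrite /min_positive_codegree; case: ifPn => // H0 _; split=> //.
have [|i Pi ->] := @eq_bigmax_cond _
  [pred i : 'I_#|edges H|.+1 | positive_codegree_geq H i] (fun i => i : nat).
  (* The value 0 is always admissible, so the maximum is attained. *)
  by apply/card_gt0P; exists ord0; apply/forallP => P; apply/implyP.
exact: Pi.
Qed.

(** Since edges have three elements, membership forces [x], [y], [z] to be distinct; in particular
    the set is empty when [x = y]. *)
Definition conbhd x y : {set T} := [set z | z |: [set x; y] \in edges H].

Lemma conbhd_neq {x y z} : z \in conbhd x y -> [/\ x != y, z != x & z != y].
Proof.
rewrite inE => /edge_card3; rewrite cardsU1 cards2 !inE.
by case: (x == y); case: (z == x); case: (z == y).
Qed.

Lemma conbhdC x y : conbhd x y = conbhd y x.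
Proof. by apply/setP => z; rewrite !inE [[set x; y]]setUC. Qed.

Lemma conbhd_rot {x y z} : z \in conbhd x y -> x \in conbhd y z.
Proof.
by rewrite !inE => zxy; rewrite setUA [_ :|: [set z]]setUC.
Qed.

(** An edge through the pair is determined by its third vertex, so adding that vertex to the pair is
    a bijection. *)
Lemma codegreeE x y : x != y -> codegree H [set x; y] = #|conbhd x y|.
Proof.
move=> xy; rewrite /codegree -(@card_in_imset _ _ (fun z => z |: [set x; y])).
  apply: eq_card => e; rewrite inE; apply/andP/imsetP => [[eH Pe]|[z zN ->]].
    have : #|e :\: [set x; y]| = 1.
      by rewrite cardsD (setIidPr Pe) cards2 xy edge_card3.
    move=> /eqP/cards1P[z ez].
    have defe : e = z |: [set x; y].
      by rewrite -ez -{1}(setID e [set x; y]) (setIidPr Pe) setUC.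
    by exists z => //; rewrite inE -defe.
  by rewrite subsetUr; move: zN; rewrite inE.
move=> z z' /conbhd_neq[_ zx zy] _ /setP/(_ z).
by rewrite !inE eqxx (negbTE zx) (negbTE zy) !orbF => /esym/eqP.
Qed.

Lemma leq_card_conbhd k x y z :
  positive_codegree_geq H k -> z \in conbhd x y -> k <= #|conbhd x y|.
Proof.
move=> /forallP/(_ [set x; y])/implyP Hk zN; have [xy _ _] := conbhd_neq zN.
rewrite -codegreeE //; apply: Hk; rewrite cards2 xy /=.
apply/existsP; exists (z |: [set x; y]); rewrite subsetUr andbT.
by move: zN; rewrite inE.
Qed.

Lemma edge_conbhd e : e \in edges H -> exists x y z, z \in conbhd x y.
Proof.
move=> eH; have := edge_card3 eH; rewrite cardE.
case E: (enum e) => [|x [|y [|z []]]] // _; exists x, y, z.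
rewrite inE; suff -> : z |: [set x; y] = e by [].
by apply/setP => t; rewrite -(mem_enum e) E !inE orbC orbA.
Qed.

(** Here [x], [y], [z] play the vertices 1, 2, 3 of [F33] and [a], [b], [c] play 4, 5, 6. *)
Lemma contains_F33 x y z a b c :
  z \in conbhd x y ->
  {in [:: x; y; z], forall t,
    [/\ t \in conbhd a b, t \in conbhd a c & t \in conbhd b c]} ->
  contains F33 H.
Proof.
move=> zN tN; have [xy zx zy] := conbhd_neq zN.
have [xab xac xbc] := tN x (mem_head _ _).
have [yab yac ybc] : [/\ y \in conbhd a b, y \in conbhd a c & y \in conbhd b c].
  by apply: tN; rewrite !inE eqxx orbT.
have [zab zac zbc] : [/\ z \in conbhd a b, z \in conbhd a c & z \in conbhd b c].
  by apply: tN; rewrite !inE eqxx !orbT.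
have [ab xa xb] := conbhd_neq xab; have [ac _ xc] := conbhd_neq xac.
have [_ ya yb] := conbhd_neq yab; have [bc _ yc] := conbhd_neq ybc.
have [_ za zb] := conbhd_neq zab; have [_ _ zc] := conbhd_neq zac.
pose s := [:: x; y; z; a; b; c].
have us : uniq s.
  rewrite /s /= !inE !negb_or xy ab ac bc xa xb xc ya yb yc za zb zc.
  by rewrite (eq_sym x) (eq_sym y) zx zy.
apply/existsP; exists [ffun i : 'I_6 => nth x s i]; apply/andP; split.
  apply/injectiveP => i j; rewrite !ffunE => /eqP.
  by rewrite nth_uniq // => /eqP/val_inj.
have f3 i j k : i < 6 -> j < 6 -> k < 6 ->
    [ffun i : 'I_6 => nth x s i] @: triple6 i.+1 j.+1 k.+1 =
    nth x s i |: [set nth x s j; nth x s k].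
  move=> i6 j6 k6; rewrite /triple6 !imsetU !imset_set1 !ffunE /= !inordK //.
  by rewrite setUA.
apply/subsetP => _ /imsetP[e eF ->]; move: eF; rewrite !inE.
(* [f3] singles out the first vertex of a triple, so the edge 123 must be read as [x] being a
   neighbour of [y] and [z]. *)
move: (conbhd_rot zN) xab xac xbc yab yac ybc zab zac zbc.
rewrite !inE => xyz xab xac xbc yab yac ybc zab zac zbc.
by do ![case/orP] => /eqP ->; rewrite f3.
Qed.

Lemma positive_codegree_contains_F33 k :
  edges H != set0 -> positive_codegree_geq H k -> 3 * #|T| < 4 * k ->
  contains F33 H.
Proof.
case/set0Pn => e /edge_conbhd[a [b [c cab]]] Hk ltk.
have abc := conbhd_rot cab; have bca := conbhd_rot abc.
pose D := conbhd a b :&: conbhd a c :&: conbhd b c.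
(* Inclusion-exclusion applied twice gives [#|D| >= 3 * k - 2 * #|T|], which exceeds [#|T| - k] by
   the hypothesis on [k]. *)
have ltD : #|T| < #|D| + k.
  have kab := leq_card_conbhd Hk cab; have kbc := leq_card_conbhd Hk abc.
  have := leq_card_conbhd Hk bca; rewrite conbhdC => kac.
  have := cardsUI (conbhd a b) (conbhd a c).
  have := cardsUI (conbhd a b :&: conbhd a c) (conbhd b c).
  have := max_card (conbhd a b :|: conbhd a c).
  have := max_card (conbhd a b :&: conbhd a c :|: conbhd b c).
  rewrite -/D; lia.
have ND x y z : z \in conbhd x y -> exists2 t, t \in conbhd x y & t \in D.
  move=> /(leq_card_conbhd Hk) kN.
  have : 0 < #|conbhd x y :&: D|.
    have := cardsUI (conbhd x y) D; have := max_card (conbhd x y :|: D); lia.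
  by case/card_gt0P => t /setIP[tN tD]; exists t.
have [x _ xD] := ND _ _ _ cab.
have /setIP[/setIP[xab _] _] := xD.
have [y yxa yD] := ND _ _ _ (conbhd_rot (conbhd_rot xab)).
(* The choice of [y] as a neighbour of the pair [x], [a] is what puts the pair [x], [y] inside an
   edge. *)
have axy : a \in conbhd x y by rewrite conbhdC; apply/conbhd_rot/conbhd_rot.
have [z zxy zD] := ND _ _ _ axy.
apply: (contains_F33 (a := a) (b := b) (c := c) zxy) => t.
move=> txyz; have /setIP[/setIP[tab tac] tbc] : t \in D.
  by move: txyz; rewrite in_cons mem_seq2 => /or3P[] /eqP ->.
by split.
Qed.

End PositiveCodegree.

(** * Rainbow triples of a colouring, and the lower bound *)

Section PartiteGraph.
Local Open Scope nat_scope.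
Context {T C : finType} (c : T -> C).

Definition partite_edges : {set {set T}} :=
  [set e : {set T} | (#|e| == 3) && (#|c @: e| == 3)].

Lemma partite_edges_card3 : [forall e in partite_edges, #|e| == 3].
Proof. by apply/forall_inP => e; rewrite inE => /andP[]. Qed.

Definition partite_graph : three_graph T := ThreeGraph partite_edges_card3.

Lemma partite_edge_inj e : e \in edges partite_graph -> {in e &, injective c}.
Proof. by rewrite inE => /andP[/eqP e3 ce3]; apply/imset_injP; rewrite e3. Qed.

Lemma conbhd_partite x y z :
  uniq [:: c z; c x; c y] -> z \in conbhd partite_graph x y.
Proof.
rewrite /= !inE negb_or andbT => /andP[/andP[zx zy] xy].
have neq s t : c s != c t -> (s == t) = false.
  by apply: contraNF => /eqP ->.
rewrite cardsU1 cards2 !inE !neq //=.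
by rewrite !imsetU !imset_set1 cardsU1 cards2 !inE negb_or zx zy xy.
Qed.

End PartiteGraph.

Local Open Scope nat_scope.

Lemma F33_edge_pair (i j : 'I_6) :
  exists2 e, e \in edges F33 & (i \in e) && (j \in e).
Proof.
pose L := [:: (1,2,3); (1,4,5); (1,4,6); (1,5,6); (2,4,5); (2,4,6); (2,5,6);
              (3,4,5); (3,4,6); (3,5,6)].
pose m (i : nat) (t : nat * nat * nat) :=
  (i == t.1.1.-1) || (i == t.1.2.-1) || (i == t.2.-1).
(* The edges are mirrored by triples of numbers, on which the covering of all pairs, [i = j]
   included, is settled by computation. *)
have cov : all (fun i => all (fun j => has (fun t => m i t && m j t) L)
  (iota 0 6)) (iota 0 6) by [].
have mE t (l : 'I_6) : t \in L -> (l \in triple6 t.1.1 t.1.2 t.2) = m l t.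
  by rewrite !inE; do ![case/orP] => /eqP -> /=; rewrite -!val_eqE /= !inordK.
have /allP/(_ i) := cov; rewrite mem_iota ltn_ord => /(_ isT).
move=> /allP/(_ j); rewrite mem_iota ltn_ord => /(_ isT).
case/hasP => t tL; rewrite -!mE // => ij; exists (triple6 t.1.1 t.1.2 t.2) => //.
pose F u := triple6 u.1.1 u.1.2 u.2.
by have -> : edges F33 = [set:: map F L] by []; rewrite in_set (map_f F).
Qed.

Lemma partite_F33_free (T C : finType) (c : T -> C) :
  #|C| < 6 -> is_free F33 (partite_graph c).
Proof.
move=> C6; apply: contraL C6 => /existsP[f /andP[/injectiveP finj /subsetP fF]].
rewrite -leqNgt -[6]card_ord; apply: (@leq_card _ _ (c \o f)) => i j /= cij.
have [e eF /andP[ie je]] := F33_edge_pair i j.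
apply: finj; apply: (partite_edge_inj (fF _ (imset_f _ eF)) _ _ cij);
  exact: imset_f.
Qed.

(** [phi] picks [m] vertices of each colour. A pair inside an edge has two colours, and every picked
    vertex of another colour completes it to an edge. *)
Lemma partite_positive_codegree (T C : finType) (m : nat)
    (phi : C * 'I_m -> T) (c : T -> C) :
  injective phi -> (forall u, c (phi u) = u.1) ->
  positive_codegree_geq (partite_graph c) ((#|C| - 2) * m).
Proof.
move=> phi_inj cphi; apply/forallP => P; apply/implyP.
case/andP => /cards2P[x [y [xy ->]]] /existsP[e /andP[eH]].
rewrite subUset !sub1set => /andP[xe ye].
have cxy : c x != c y.
  by apply: contraNneq xy => cxy; apply/eqP; apply: (partite_edge_inj eH).
rewrite codegreeE //.
have -> : (#|C| - 2) * m = #|phi @: setX (~: [set c x; c y]) [set: 'I_m]|.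
  by rewrite card_imset // cardsX cardsT card_ord [in RHS]cardsCs setCK cards2 cxy.
apply: subset_leq_card; apply/subsetP => _ /imsetP[[r j] rj ->].
apply: conbhd_partite.
by move: rj; rewrite cphi /= !inE !negb_or !andbT => ->.
Qed.

Lemma coex_pos_F33_lower (n : nat) : 3 * (n %/ 5) <= coex_pos n F33.
Proof.
set m := n %/ 5; have [->//|m_gt0] := posnP m.
have ltn_phi (u : 'I_5 * 'I_m) : u.2 * 5 + u.1 < n.
  have := leq_trunc_div n 5; rewrite -/m.
  by have := ltn_ord u.1; have := ltn_ord u.2; lia.
(* The [j]-th vertex of colour [r] is [5 * j + r], which is below [5 * m <= n]. *)
pose phi u := Ordinal (ltn_phi u).
pose c (i : 'I_n) : 'I_5 := inord (i %% 5).
have cphi u : c (phi u) = u.1.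
  by apply: ord_inj; rewrite inordK ?ltn_pmod //= modnMDl modn_small.
have phi_inj : injective phi.
  move=> u v uv; have eq1 : u.1 = v.1 by rewrite -!cphi uv.
  case: u v eq1 uv => [r j] [s k] /= -> /(congr1 val) /= jk.
  by congr (_, _); apply: val_inj => /=; lia.
pose H := partite_graph c.
suff : 3 * m <= min_positive_codegree H.
  move=> le3; apply: leq_trans le3 _.
  by apply: (@leq_bigmax_cond _ _ (@min_positive_codegree _));
    apply: partite_F33_free; rewrite card_ord.
apply: leq_min_positive_codegree; last first.
  by have := partite_positive_codegree phi_inj cphi; rewrite card_ord.
(* As [m > 0], the vertices 0, 1, 2 exist and form an edge, so the convention for edgeless graphs
   does not apply. *)
pose v r := phi (inord r, Ordinal m_gt0).
have : v 2 \in conbhd H (v 0) (v 1).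
  by apply: conbhd_partite; rewrite !cphi /= !inE -!val_eqE /= !inordK.
by rewrite inE => vH; apply/set0Pn; exists (v 2 |: [set v 0; v 1]).
Qed.

Lemma coex_pos_F33_upper (n : nat) : 4 * coex_pos n F33 <= 3 * n.
Proof.
(* The bound holds for 0 and passes to maxima, so a single free graph remains to be treated. *)
rewrite /coex_pos; elim/big_ind: _ => [|a b ha hb|H free]; first by [].
  by rewrite /maxn; case: ifP.
rewrite leqNgt; apply: contra free => lt.
have [|H0 Hk] := @min_positive_codegreeP _ H; first by lia.
by apply: positive_codegree_contains_F33 H0 Hk _; rewrite card_ord.
Qed.

Local Close Scope nat_scope.

Unset Implicit Arguments.

Theorem theorem13 (n : nat) (n_gt0 : (0 < n)%N) :
  (3 * (n %/ 5) <= coex_pos n F33)%N /\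
  (coex_pos n F33)%:R <= 3 / 4 * n%:R :> rat.
Proof.
split; first exact: coex_pos_F33_lower.
have := coex_pos_F33_upper n; rewrite -(ler_nat rat) !natrM; lra.
Qed.
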